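(* Let $\mathcal{X}$ be a set, $E$ a Banach space, and let $\mathcal{B}$ be a GRKBS of functions $\mathcal{X}\to E$ with two configurations $(\mathcal{F}_1,\phi_1)$ and $(\mathcal{F}_2,\phi_2)$. For $i=1,2$ let $\mathcal{K}_i:\mathcal{X}\times\mathcal{F}_i/\mathcal{N}_{\phi_i}\to E$, $\mathcal{K}_i(x,\mu+\mathcal{N}_{\phi_i})=\phi_i(x)(\mu)$, be the generalized reproducing kernel associated with $(\mathcal{F}_i,\phi_i)$, and define $\phi_{\mathcal{K}_i}:\mathcal{X}\to L_{\mathrm{op}}(\mathcal{F}_i/\mathcal{N}_{\phi_i},E)$ by $\phi_{\mathcal{K}_i}(x)=\mathcal{K}_i(x,\cdot)$. Then: (1) the pairs $(\mathcal{F}_1/\mathcal{N}_{\phi_1},\phi_{\mathcal{K}_1})$ and $(\mathcal{F}_2/\mathcal{N}_{\phi_2},\phi_{\mathcal{K}_2})$ both belong to the trivial equivalence class of configurations of $\mathcal{B}$; (2) in particular, for all $\mu_1+\mathcal{N}_{\phi_1}\in\mathcal{F}_1/\mathcal{N}_{\phi_1}$, $$\mathcal{K}_1(x,\mu_1+\mathcal{N}_{\phi_1})=\mathcal{K}_2\bigl(x,(\phi^{(2)}_* )^{-1}\circ\phi^{(1)}_*(\mu_1+\mathcal{N}_{\phi_1})\bigr)\qquad\forall x\in\mathcal{X},$$ where $\phi^{(i)}_*:\mathcal{F}_i/\mathcal{N}_{\phi_i}\to\mathcal{B}$, $\phi^{(i)}_*(\mu+\mathcal{N}_{\phi_i})=\phi_i(\cdot)(\mu)$,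 are the associated isometric isomorphisms.
   Context: $L_{\mathrm{op}}(\mathcal{F},E)$ denotes the bounded linear operators from $\mathcal{F}$ to $E$; $\cong$ means isometrically isomorphic. A GRKBS is a Banach space $\mathcal{B}$ of functions $f:\mathcal{X}\to E$ (pointwise operations) for which every evaluation operator $ev_x(f)=f(x)$ is bounded from $\mathcal{B}$ to $E$. A configuration of $\mathcal{B}$ is a pair $(\mathcal{F},\phi)$ with $\mathcal{F}$ a Banach space and $\phi:\mathcal{X}\to L_{\mathrm{op}}(\mathcal{F},E)$ such that $\mathcal{B}=\{f_\mu:\mu\in\mathcal{F}\}$, $f_\mu(x)=\phi(x)(\mu)$, and $\|f\|_{\mathcal{B}}=\inf\{\|\mu\|_{\mathcal{F}}:f=f_\mu\}$. Put $\mathcal{N}_\phi=\bigcap_{x\in\mathcal{X}}\ker\phi(x)$; $\mathcal{F}/\mathcal{N}_\phi$ carries the quotient norm. Two configurations $(\mathcal{F},\phi)$ and $(\widetilde{\mathcal{F}},\widetilde\phi)$ of $\mathcal{B}$ are equivalent if there is an isometric isomorphism $\mathcal{J}:\widetilde{\mathcal{F}}\to\mathcal{F}$ with $\widetilde\phi(x)(\widetilde\mu)=\phi(x)(\mathcal{J}\widetilde\mu)$ for all $x\in\mathcal{X}$, $\widetilde\mu\in\widetilde{\mathcal{F}}$; this is an equivalence relation on configurations of $\mathcal{B}$. The trivial configuration is $(\mathcal{B},\phi_{\mathrm{triv}})$ with $\phi_{\mathrm{triv}}(x)=ev_x$, and the trivial equivalence class is its class. *)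

(* Defs.v *)
From HB Require Import structures.
From mathcomp Require Import all_boot all_order all_algebra complex.
From mathcomp Require Import all_classical all_reals all_analysis.

Set Implicit Arguments.
Unset Strict Implicit.
Unset Printing Implicit Defensive.

Import Order.TTheory GRing.Theory Num.Theory.
Import numFieldNormedType.Exports.

Local Open Scope classical_set_scope.
Local Open Scope ring_scope.
Local Open Scope quotient_scope.

(* Banach spaces may be real or complex; both cases are treated at once, with
   all the spaces in play over the same scalars. *)
Variant scalars := RealScalars | ComplexScalars.

Definition scalar_field (R : realType) (s : scalars) : numFieldType :=
  if s is ComplexScalars then (R[i] : numFieldType) else (R : numFieldType).

Section ScalarFacts.
Variables (R : realType) (s : scalars).
Local Notation K := (scalar_field R s).

(* Norms take their values in K, so infima of sets of norms are computed with
   the generic [infimum] of a partial order, which this lemma makes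
   meaningful. *)
Lemma infimum_ge0P (A : set K) : A !=set0 -> (forall a, A a -> 0 <= a) ->
  infimums A (infimum 0 A).
Proof.
move=> A0 Age0.
have [g gA] : exists g, infimums A g.
  case: s A A0 Age0 => /= A A0 Age0.
    have hA : has_inf A by split=> //; exists 0 => x /Age0.
    exists (inf A); split; first by move=> x Ax; apply: ge_inf => //; case: hA.
    by move=> y yA; apply: lb_le_inf.
  pose A' : set R := (@complex.Re R) @` A.
  have hA : has_inf A'.
    split; first by case: A0 => a Aa; exists (complex.Re a), a.
    by exists 0 => _ [x /Age0 + <-]; rewrite lecE => /andP[].
  exists ((inf A')%:C)%C; split.
    move=> x Ax; have := Age0 _ Ax.
    rewrite !lecE /= => /andP[/eqP <- _]; rewrite eqxx /=.
    by apply: ge_inf; [case: hA|exists x].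
  move=> y yA; case: (A0) => a Aa.
  have := yA _ Aa; have := Age0 _ Aa.
  rewrite !lecE /= => /andP[/eqP -> _] /andP[/eqP <- _]; rewrite eqxx /=.
  apply: lb_le_inf; first by case: hA.
  by move=> _ [x Ax <-]; have := yA _ Ax; rewrite lecE => /andP[].
rewrite /infimum; case: eqP => [A00|_]; last exact: (xgetI _ gA).
by case: A0 => a; rewrite A00.
Qed.

Lemma half_exp_lt (e : K) : 0 < e -> exists n, 2^-1 ^+ n < e.
Proof.
have realP (e' : R) : 0 < e' -> exists n, 2^-1 ^+ n < e'.
  move=> e0; exists (Num.truncn e'^-1).+1.
  rewrite exprVn invf_plt ?posrE ?exprn_gt0//.
  have := truncnS_gt e'^-1; move=> /lt_trans; apply.
  by rewrite -natrX ltr_nat ltn_expl.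
case: s e => /= e; first exact: realP.
rewrite ltcE /= => /andP[/eqP eIm /realP [n ne]]; exists n.
have -> : (2^-1 ^+ n : R[i]) = ((2^-1 ^+ n)%:C)%C.
  by rewrite rmorphXn /= fmorphV rmorph_nat.
by rewrite ltcE /= eIm eqxx.
Qed.

End ScalarFacts.

Record closed_subspace (K : numFieldType) (F : normedModType K) :=
  ClosedSubspace {
    subspace_pred :> {pred F};
    subspace_submod : submod_closed subspace_pred;
    subspace_closed : closed [set mu | mu \in subspace_pred]
  }.

HB.instance Definition _ (K : numFieldType) (F : normedModType K)
    (N : closed_subspace F) :=
  GRing.isSubmodClosed.Build K F (subspace_pred N)
    (GRing.submod_closed_semi (subspace_submod N)).

Section QuotientLmodule.
Variables (K : numFieldType) (F : normedModType K) (N : closed_subspace F).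

Definition quotient_space := Quotient.quot N.

HB.instance Definition _ := Choice.on quotient_space.
HB.instance Definition _ := GRing.Zmodule.on quotient_space.
HB.instance Definition _ := EqQuotient.on quotient_space.

Definition coset_of (mu : F) : quotient_space := \pi_quotient_space mu.

Lemma coset_ofP mu nu : coset_of mu = coset_of nu <-> mu - nu \in N.
Proof.
by rewrite (Quotient.idealrBE N); split=> /eqP.
Qed.

Lemma coset_of_repr (q : quotient_space) : coset_of (repr q) = q.
Proof. exact: reprK. Qed.

Lemma coset_ofD mu nu : coset_of (mu + nu) = coset_of mu + coset_of nu.
Proof. exact: (pi_addr (s := Quotient.quot N)). Qed.

Definition quotient_scale (a : K) (q : quotient_space) : quotient_space :=
  coset_of (a *: repr q).

Lemma coset_ofZ a mu : coset_of (a *: mu) = quotient_scale a (coset_of mu).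
Proof.
apply/coset_ofP; rewrite -scalerBr; apply: rpredZ.
by apply/coset_ofP; rewrite coset_of_repr.
Qed.

Let scaleA a b v :
  quotient_scale a (quotient_scale b v) = quotient_scale (a * b) v.
Proof. by rewrite -(coset_of_repr v) -!coset_ofZ scalerA. Qed.

Let scale1 : left_id 1 quotient_scale.
Proof. by move=> v; rewrite -(coset_of_repr v) -!coset_ofZ scale1r. Qed.

Let scaleDr : right_distributive quotient_scale +%R.
Proof.
move=> a v w; rewrite -(coset_of_repr v) -(coset_of_repr w).
by rewrite -coset_ofD -!coset_ofZ scalerDr coset_ofD.
Qed.

Let scaleDl v : {morph quotient_scale^~ v : a b / a + b}.
Proof.
move=> a b /=; rewrite -(coset_of_repr v).
by rewrite -!coset_ofZ scalerDl coset_ofD.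
Qed.

HB.instance Definition _ := GRing.Zmodule_isLmodule.Build K quotient_space
  scaleA scale1 scaleDr scaleDl.

Lemma coset_of_is_linear : linear coset_of.
Proof. by move=> a u v; rewrite coset_ofD coset_ofZ. Qed.

HB.instance Definition _ := GRing.isLinear.Build K F quotient_space _ coset_of
  coset_of_is_linear.

Definition quotient_norm (q : quotient_space) : K :=
  infimum 0 [set `|mu| | mu in [set mu | coset_of mu = q]].

End QuotientLmodule.

Section QuotientNorm.
Variables (R : realType) (s : scalars).
Local Notation K := (scalar_field R s).
Variables (F : normedModType K) (N : closed_subspace F).
Local Notation Q := (quotient_space N).

Lemma quotient_norm_infimums (q : Q) :
  infimums [set `|mu| | mu in [set mu | coset_of N mu = q]] (quotient_norm q).
Proof.
apply: infimum_ge0P; first by exists `|repr q|, (repr q); rewrite //= coset_of_repr.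
by move=> _ [mu _ <-].
Qed.

Lemma quotient_norm_le mu : quotient_norm (coset_of N mu) <= `|mu|.
Proof. by have [+ _] := quotient_norm_infimums (coset_of N mu); apply; exists mu. Qed.

Lemma le_quotient_norm (q : Q) (c : K) :
  (forall mu, coset_of N mu = q -> c <= `|mu|) -> c <= quotient_norm q.
Proof.
move=> cq; have [_] := quotient_norm_infimums q; apply.
by move=> _ [mu muq <-]; exact: cq.
Qed.

Lemma quotient_norm_ge0 (q : Q) : 0 <= quotient_norm q.
Proof. by apply: le_quotient_norm => mu _; exact: normr_ge0. Qed.

Lemma quotient_norm_adherent (q : Q) (c : K) : quotient_norm q < c ->
  exists2 mu, coset_of N mu = q & `|mu| < c.
Proof.
move=> qc; apply: contrapT => h.
have cR : c \is Num.real.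
  by rewrite ger0_real// (le_trans (quotient_norm_ge0 q))// ltW.
suff : c <= quotient_norm q by move=> /(lt_le_trans qc); rewrite ltxx.
apply: le_quotient_norm => mu muq; rewrite real_leNgt//.
by apply/negP => muc; apply: h; exists mu.
Qed.

Let norm_triangle (p q : Q) :
  quotient_norm (p + q) <= quotient_norm p + quotient_norm q.
Proof.
rewrite -lerBlDr; apply: (le_quotient_norm (q := p)) => mu mup.
rewrite lerBlDr [leRHS]addrC -lerBlDr; apply: (le_quotient_norm (q := q)) => nu nuq.
rewrite lerBlDr [leRHS]addrC -mup -nuq -linearD.
by rewrite (le_trans (quotient_norm_le _))// ler_normD.
Qed.

Let norm_scale_le (a : K) (q : Q) :
  quotient_norm (a *: q) <= `|a| * quotient_norm q.
Proof.
have [->|a0] := eqVneq a 0.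
  rewrite scale0r normr0 mul0r -(linear0 (coset_of N)).
  by rewrite (le_trans (quotient_norm_le _))// normr0.
rewrite -ler_pdivrMl ?normr_gt0//; apply: le_quotient_norm => mu <-.
by rewrite ler_pdivrMl ?normr_gt0// -normrZ -linearZ quotient_norm_le.
Qed.

Let norm_scale (a : K) (q : Q) : quotient_norm (a *: q) = `|a| * quotient_norm q.
Proof.
apply/eqP; rewrite eq_le norm_scale_le/=.
have [->|a0] := eqVneq a 0; first by rewrite normr0 mul0r quotient_norm_ge0.
rewrite -ler_pdivlMl ?normr_gt0// -normfV.
by rewrite -[in leLHS](scalerK a0 q) norm_scale_le.
Qed.

Let norm_eq0 (q : Q) : quotient_norm q = 0 -> q = 0.
Proof.
move=> q0; rewrite -(coset_of_repr q) -(linear0 (coset_of N)).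
apply/coset_ofP; rewrite subr0.
apply: (@subspace_closed _ _ N) => U /nbhs_normP [e /= e0 eU].
have /quotient_norm_adherent [nu nuq nue] : quotient_norm q < e by rewrite q0.
exists (repr q - nu); split => /=.
  by apply/coset_ofP; rewrite coset_of_repr.
by apply: eU => /=; rewrite opprB addrC subrK.
Qed.

HB.instance Definition _ := @Lmodule_isNormed.Build K Q
  (@quotient_norm K F N) norm_triangle norm_scale norm_eq0.

Lemma quotient_normE (q : Q) : `|q| = quotient_norm q. Proof. by []. Qed.

End QuotientNorm.

Section QuotientComplete.
Variables (R : realType) (s : scalars).
Local Notation K := (scalar_field R s).
Variables (F : completeNormedModType K) (N : closed_subspace F).
Local Notation Q := (quotient_space N).

Let quotient_complete (G : set_system Q) :
  ProperFilter G -> cauchy G -> cvg G.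
Proof.
move=> GF /cauchyP Gc.
pose r n : K := 2^-1 ^+ n.
have r0 n : 0 < r n by rewrite exprn_gt0.
have rS n : r n = r n.+1 + r n.+1.
  by rewrite /r exprSr -splitr.
have /choice[q Gq] : forall n, exists q, G (ball q (r n.+1)) by move=> n; exact: Gc.
have rle n m : (n <= m)%N -> r m <= r n.
  by move=> nm; rewrite /r ler_wiXn2l// ?invr_ge0// invf_le1// ler1n.
have qd n : `|q n.+1 - q n| < r n.
  have [z [z1 z2]] := filter_ex (filterI (Gq n) (Gq n.+1)).
  move: z1 z2; rewrite -!ball_normE /= => z1 z2.
  rewrite -(subrK z (q n.+1)) -addrA (le_lt_trans (ler_normD _ _))//.
  rewrite rS ltrD//; last by rewrite distrC.
  by rewrite (lt_le_trans z2)// rle.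
have lift n (mu : F) : coset_of N mu = q n ->
    exists nu, coset_of N nu = q n.+1 /\ `|nu - mu| < r n.
  move=> muq; have /quotient_norm_adherent[d dq dr] := qd n.
  exists (mu + d); split; first by rewrite linearD/= muq dq addrC subrK.
  by rewrite [mu + d]addrC addrK.
have /choice[next nextP] : forall x : nat * F, exists nu,
    coset_of N x.2 = q x.1 -> coset_of N nu = q x.1.+1 /\ `|nu - x.2| < r x.1.
  move=> [n mu] /=; have [/lift[nu ?]|?] := pselect (coset_of N mu = q n).
    by exists nu.
  by exists 0.
pose mu := fix mu n := if n is m.+1 then next (m, mu m) else repr (q 0).
have muq n : coset_of N (mu n) = q n.
  elim: n => [|n IH] /=; first by rewrite coset_of_repr.
  by have [] := nextP (n, mu n) IH.
have mud n : `|mu n.+1 - mu n| < r n by have [] := nextP (n, mu n) (muq n).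
have mudk n k : `|mu (n + k)%N - mu n| <= r n + r n - (r (n + k)%N + r (n + k)%N).
  elim: k => [|k IH]; first by rewrite addn0 !subrr normr0.
  rewrite addnS -(subrK (mu (n + k)%N) (mu _.+1)) -addrA.
  rewrite (le_trans (ler_normD _ _))//.
  rewrite (le_trans (lerD (ltW (mud _)) IH))// -rS.
  rewrite addrCA lerD2l opprD addrA subrr add0r.
  by rewrite lexx.
have mudm n m : (n <= m)%N -> `|mu m - mu n| <= r n + r n.
  move=> /subnKC <-; rewrite (le_trans (mudk _ _))// lerBlDr lerDl.
  by rewrite addr_ge0// ltW.
have small (e : K) : 0 < e -> exists n, r n + r n < e.
  move=> /half_exp_lt [n ne]; exists n.+1; by rewrite -rS.
have : cvg (mu @ \oo).
  apply: cauchy_cvg; apply/cauchyP => e /small[n ne].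
  exists (mu n); exists n => // m /= nm.
  by rewrite -ball_normE /= distrC (le_lt_trans _ ne)// mudm.
move=> /cvg_ex [l mul]; apply/cvg_ex; exists (coset_of N l).
apply/cvg_ballP => e e0.
have e20 : 0 < e / 2 by rewrite divr_gt0.
have [n ne] := small _ e20.
have [M _ Ml] := (cvg_ballP _ _).1 mul _ e20.
pose m := maxn n M.
have : ball l (e / 2) (mu m) by apply: Ml; rewrite /= leq_maxr.
rewrite -ball_normE /= => lm.
apply: filterS (Gq m) => z; rewrite -!ball_normE /= => zm.
rewrite -(subrK (q m) (coset_of N l)) -addrA (le_lt_trans (ler_normD _ _))//.
rewrite [e]splitr ltrD//.
  by rewrite -muq -linearB (le_lt_trans _ lm)// quotient_norm_le.
rewrite (lt_le_trans zm)// (le_trans _ (ltW ne))//.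
apply: (@le_trans _ _ (r n)); last by rewrite lerDl ltW.
by rewrite rle// (leq_trans (leq_maxl n M)).
Qed.

HB.instance Definition _ := Uniform_isComplete.Build Q quotient_complete.

End QuotientComplete.

Definition isometric_isomorphism (K : numFieldType) (F G : normedModType K)
    (J : F -> G) : Prop :=
  [/\ linear J, bijective J & forall mu, `|J mu| = `|mu|].

Record bounded_operator (K : numFieldType) (F E : normedModType K) :=
  BoundedOperator {
    operator :> {linear F -> E};
    operator_bounded : exists C, forall mu, `|operator mu| <= C * `|mu|
  }.

(* A Banach space of functions X -> E is a Banach space [grkbs_space] with a
   linear injection [grkbs_fun] sending each element to the function it is;
   linearity says that the operations are pointwise. *)
Record grkbs (K : numFieldType) (X : Type) (E : completeNormedModType K) :=
  GRKBS {
    grkbs_space :> completeNormedModType K;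
    grkbs_fun : {linear grkbs_space -> (X -> E)};
    grkbs_fun_inj : injective grkbs_fun;
    grkbs_eval_bounded : forall x,
      exists C, forall f : grkbs_space, `|grkbs_fun f x| <= C * `|f|
  }.

Arguments grkbs_fun {K X E g}.

Record feature_pair (K : numFieldType) (X : Type)
    (E : completeNormedModType K) :=
  FeaturePair {
    feature_space : completeNormedModType K;
    feature_map :> X -> bounded_operator feature_space E
  }.

Section Configurations.
Variables (K : numFieldType) (X : Type) (E : completeNormedModType K).
Implicit Types (B : grkbs X E) (p : feature_pair X E).

Definition feature_fun p (mu : feature_space p) : X -> E := fun x => p x mu.

Definition is_configuration B p : Prop :=
  range (@grkbs_fun _ _ _ B) = range (@feature_fun p) /\
  forall f : B, `|f| =
    infimum 0 [set `|mu| | mu in [set mu | grkbs_fun f = @feature_fun p mu]].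

Definition equivalent_configurations p p' : Prop :=
  exists J : feature_space p' -> feature_space p,
    isometric_isomorphism J /\ forall x mu, p' x mu = p x (J mu).

Section Evaluation.
Variables (B : grkbs X E) (x : X).

Definition evaluation (f : B) : E := grkbs_fun f x.

Lemma evaluation_is_linear : linear evaluation.
Proof. by move=> a f g; rewrite /evaluation linearP. Qed.

HB.instance Definition _ := GRing.isLinear.Build K B E _ evaluation
  evaluation_is_linear.

Definition evaluation_operator : bounded_operator B E :=
  @BoundedOperator K B E evaluation (grkbs_eval_bounded B x).

End Evaluation.

Definition trivial_configuration B : feature_pair X E :=
  FeaturePair (@evaluation_operator B).

Definition trivial_class B p : Prop :=
  is_configuration B p /\
  equivalent_configurations (trivial_configuration B) p.

End Configurations.

Section NullSpace.
Variables (K : numFieldType) (X : Type) (E : completeNormedModType K).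
Variable p : feature_pair X E.

Definition null_space : {pred feature_space p} :=
  [pred mu | `[< forall x, p x mu = 0 >]].

Lemma null_spaceP mu : reflect (forall x, p x mu = 0) (mu \in null_space).
Proof. exact: asboolP. Qed.

Let null_space_submod : submod_closed null_space.
Proof.
split=> [|a u v /null_spaceP u0 /null_spaceP v0]; apply/null_spaceP => x.
  by rewrite linear0.
by rewrite linearP u0 v0 scaler0 addr0.
Qed.

Let null_space_closed : closed [set mu | mu \in null_space].
Proof.
move=> mu clmu; apply/null_spaceP => x.
have [C pC] := operator_bounded (p x).
apply/eqP; rewrite -normr_eq0; apply/negPn/negP => pmu0.
have pmu : 0 < `|p x mu| by rewrite lt_def pmu0 normr_ge0.
have mu0 : 0 < `|mu|.
  rewrite normr_gt0; apply/eqP => mu0; move: pmu.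
  by rewrite mu0 linear0 normr0 ltxx.
have C0 : 0 < C by rewrite -(pmulr_lgt0 _ mu0) (lt_le_trans pmu).
have [nu [/null_spaceP nuN]] : [set nu | nu \in null_space] `&`
    [set nu | `|mu - nu| < `|p x mu| / C] !=set0.
  by apply: clmu; apply/nbhs_normP; exists (`|p x mu| / C) => //=;
    rewrite divr_gt0.
rewrite /= ltr_pdivlMr// mulrC => /(le_lt_trans (pC _)).
by rewrite linearB/= nuN subr0 ltxx.
Qed.

Definition null_subspace : closed_subspace (feature_space p) :=
  ClosedSubspace null_space_submod null_space_closed.

End NullSpace.

Section Kernel.
Variables (R : realType) (s : scalars).
Local Notation K := (scalar_field R s).
Variables (X : Type) (E : completeNormedModType K).
Implicit Types (B : grkbs X E) (p : feature_pair X E).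

Definition feature_quotient p : completeNormedModType K :=
  quotient_space (null_subspace p).

Definition generalized_kernel p (x : X) (q : feature_quotient p) : E :=
  p x (repr q).

Lemma generalized_kernelE p x mu :
  generalized_kernel x (coset_of (null_subspace p) mu) = p x mu.
Proof.
apply/eqP; rewrite -subr_eq0 -linearB; apply/eqP; move: x; apply/null_spaceP.
by apply/(@coset_ofP _ _ (null_subspace p)); rewrite coset_of_repr.
Qed.

Section KernelOperator.
Variables (p : feature_pair X E) (x : X).

Lemma generalized_kernel_is_linear : linear (@generalized_kernel p x).
Proof.
move=> a u v; rewrite -(coset_of_repr u) -(coset_of_repr v) -linearP.
by rewrite !generalized_kernelE linearP.
Qed.

HB.instance Definition _ := GRing.isLinear.Build K (feature_quotient p) E _
  (@generalized_kernel p x) generalized_kernel_is_linear.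

Lemma generalized_kernel_bounded :
  exists C, forall q, `|@generalized_kernel p x q| <= C * `|q|.
Proof.
have [C pC] := operator_bounded (p x).
have [C0|C0] := pselect (0 < C); last first.
  exists 0 => q; rewrite mul0r /generalized_kernel normr_le0.
  apply/negPn/negP => pq; apply: C0.
  have q0 : 0 < `|repr q|.
    rewrite normr_gt0; apply: contra pq => /eqP ->; by rewrite linear0.
  by rewrite -(pmulr_lgt0 _ q0) (lt_le_trans _ (pC _))// normr_gt0.
exists C => q; rewrite -ler_pdivrMl//; apply: le_quotient_norm => mu <-.
by rewrite ler_pdivrMl// generalized_kernelE.
Qed.

Definition kernel_operator : bounded_operator (feature_quotient p) E :=
  @BoundedOperator K (feature_quotient p) E (@generalized_kernel p x)
    generalized_kernel_bounded.

End KernelOperator.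

Definition quotient_pair p : feature_pair X E :=
  FeaturePair (@kernel_operator p).

(* The element of B whose underlying function is x |-> K(x, q); it exists, and
   is unique, as soon as p is a configuration of B. *)
Definition feature_star B p (q : feature_quotient p) : B :=
  xget 0 [set f : B | grkbs_fun f = fun x => generalized_kernel x q].

Lemma feature_starE B p mu : is_configuration B p ->
  grkbs_fun (feature_star B (coset_of (null_subspace p) mu)) = fun x => p x mu.
Proof.
move=> [rangeE _].
have [f _ fE] : range (@grkbs_fun _ _ _ B) (fun x => p x mu).
  by rewrite rangeE; exists mu.
rewrite /feature_star; case: xgetP => [g _ /= ->|/(_ f) /= []].
  by apply/funext => x; rewrite generalized_kernelE.
by rewrite fE; apply/funext => x; rewrite generalized_kernelE.
Qed.

End Kernel.

Arguments generalized_kernel {R s X E} p x q.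
Arguments feature_star {R s X E} B p q.

(* Main.v *)
(* Two features define the same function exactly when they differ by an element
   of the null space, so the quotient norm of a coset and the norm in B of the
   function it represents are infima of the same set. Hence the induced map
   from the quotient onto B is an isometric isomorphism intertwining the kernel
   with evaluation, which is an equivalence with the trivial configuration. *)
Require Import Defs.
From mathcomp Require Import all_boot all_order all_algebra.
From mathcomp Require Import all_classical all_reals all_analysis.

Set Implicit Arguments.
Unset Strict Implicit.
Unset Printing Implicit Defensive.

Import Order.TTheory GRing.Theory Num.Theory.
Import numFieldNormedType.Exports.

Local Open Scope classical_set_scope.
Local Open Scope ring_scope.

Lemma infimum_singleton {d : Order.disp_t} {T : porderType d} (x0 x : T) :
  infimum x0 [set x] = x.
Proof.
rewrite /infimum infimums1; case: eqP => [x_empty|_].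
  by have : [set x] x by []; rewrite x_empty.
by case: xgetP => // /(_ x) /(_ erefl).
Qed.

(** That [p] is a configuration is derived here, not assumed: surjectivity of [J] matches the two
    ranges, and the isometry makes the infimum trivial. [J] itself is then the required
    equivalence. *)
Lemma trivial_class_isometry (K : numFieldType) (X : Type)
    (E : completeNormedModType K) (B : grkbs X E) (p : feature_pair X E)
    (J : feature_space p -> B) :
  isometric_isomorphism J ->
  (forall mu, grkbs_fun (J mu) = @feature_fun K X E p mu) ->
  trivial_class B p.
Proof.
move=> Jiso JE; have [_ [I IK JK] Jnorm] := Jiso; split; last first.
  by exists J; split=> // x mu; rewrite /= /evaluation JE.
split.
  apply/seteqP; split=> _ [a _ <-]; last by exists (J a).
  by exists (I a) => //; rewrite -JE JK.
(* Each feature of [f] is sent to [f] by [J], so it has norm [|f|], and [I f] is one such feature: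
   the norms form a singleton. *)
move=> f; rewrite -[LHS](infimum_singleton 0); congr infimum.
apply/seteqP; split=> [_ ->|_ [mu /= + <-]].
  by exists (I f); rewrite /= -?JE -?Jnorm JK.
by rewrite -JE -Jnorm => /grkbs_fun_inj ->.
Qed.

Section FeatureStar.
Variables (R : realType) (s : scalars) (X : Type).
Variables (E : completeNormedModType (scalar_field R s)) (B : grkbs X E).
Variables (p : feature_pair X E) (hp : is_configuration B p).

(** This rules out the default [0] of [xget] in [feature_star] for every coset [q]. *)
Lemma feature_star_kernel (q : feature_quotient p) :
  grkbs_fun (feature_star B p q) = fun x => generalized_kernel p x q.
Proof. by rewrite -[in LHS](coset_of_repr q) (feature_starE _ hp). Qed.

Lemma coset_of_null_subspaceE (mu nu : feature_space p) :
  coset_of (null_subspace p) mu = coset_of (null_subspace p) nu <->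
  forall x, p x mu = p x nu.
Proof.
split=> [eq_munu x|eq_munu]; first by rewrite -!generalized_kernelE eq_munu.
apply/coset_ofP/null_spaceP => x.
by rewrite linearB /= eq_munu subrr.
Qed.

Lemma feature_star_norm (q : feature_quotient p) : `|feature_star B p q| = `|q|.
Proof.
have [_ ->] := hp; rewrite quotient_normE /quotient_norm; congr infimum.
(* It remains to see that the features of the function of [q] are exactly the representatives of
   [q]. *)
congr (_ @` _); apply/seteqP; split=> mu /=; rewrite feature_star_kernel.
  move=> eq_mu; rewrite -[RHS]coset_of_repr.
  apply/coset_of_null_subspaceE => x.
  by rewrite -[LHS]/(feature_fun mu x) -eq_mu.
by move=> <-; apply/funext => x; rewrite generalized_kernelE.
Qed.

Lemma feature_star_linear : linear (feature_star B p).
Proof.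
move=> a u v; apply: grkbs_fun_inj; rewrite linearP !feature_star_kernel.
by apply/funext => x; rewrite (generalized_kernel_is_linear x).
Qed.

Lemma feature_star_bijective : bijective (feature_star B p).
Proof.
(* Surjectivity comes from the range condition on [p], injectivity from having quotiented by the
   null space. *)
rewrite -setTT_bijective; split=> //; last first.
  move=> f _; have : range (@grkbs_fun _ _ _ B) (grkbs_fun f) by exists f.
  have [-> _] := hp; move=> -[mu _ muf].
  exists (coset_of (null_subspace p) mu) => //.
  by apply: grkbs_fun_inj; rewrite (feature_starE _ hp) -muf.
move=> /= u v _ _ eq_uv; rewrite -[u]coset_of_repr -[v]coset_of_repr.
apply/coset_of_null_subspaceE => x.
by have := congr1 (fun f : B => grkbs_fun f x) eq_uv; rewrite !feature_star_kernel.
Qed.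

Lemma feature_star_isometric_isomorphism :
  isometric_isomorphism (feature_star B p).
Proof.
split; [exact: feature_star_linear|exact: feature_star_bijective|].
exact: feature_star_norm.
Qed.

Lemma quotient_pair_trivial_class : trivial_class B (quotient_pair p).
Proof.
apply: (@trivial_class_isometry _ _ _ _ (quotient_pair p) (feature_star B p)).
  exact: feature_star_isometric_isomorphism.
by move=> q; rewrite feature_star_kernel.
Qed.

End FeatureStar.

Theorem theorem15 (R : realType) (s : scalars) (X : Type)
    (E : completeNormedModType (scalar_field R s)) (B : grkbs X E)
    (p1 p2 : feature_pair X E)
    (h1 : is_configuration B p1) (h2 : is_configuration B p2) :
  (trivial_class B (quotient_pair p1) /\ trivial_class B (quotient_pair p2)) /\
  (isometric_isomorphism (feature_star B p1) /\
   isometric_isomorphism (feature_star B p2) /\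
   forall (q1 : feature_quotient p1) (x : X),
     generalized_kernel p1 x q1 =
     generalized_kernel p2 x
       ((pinv [set: feature_quotient p2] (feature_star B p2)
         \o feature_star B p1) q1)).
Proof.
split; first by split; apply: quotient_pair_trivial_class.
split; first exact: feature_star_isometric_isomorphism.
split=> [|q1 x]; first exact: feature_star_isometric_isomorphism.
have [I _ IK] := feature_star_bijective h2.
have starK : feature_star B p2
    (pinv [set: feature_quotient p2] (feature_star B p2)
      (feature_star B p1 q1)) = feature_star B p1 q1.
  (* [pinv] is a right inverse only on the image, which is all of [B] by surjectivity. *)
  by apply: pinvK; rewrite inE; exists (I (feature_star B p1 q1)).
(* Both kernels evaluate this same element of [B] at [x]. *)
have := congr1 (fun f : B => grkbs_fun f x) starK.
by rewrite !feature_star_kernel.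
Qed.
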